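(* Scheduling the jobs in non-increasing $w_j$ order is a 2-approximation algorithm for $1|nr=1,p_j=1,w_j=a_j,q=2|\sum w_jC_j$. That is, for every instance of single machine scheduling with one non-renewable resource with exactly $q=2$ supplies in which every job has unit processing time $p_j=1$ and its weight equals its resource requirement, $w_j=a_j$, list scheduling the jobs in non-increasing order of $w_j$ is a polynomial time algorithm producing a feasible schedule whose total weighted completion time $\sum_j w_jC_j$ is at most $2\cdot OPT$, where $OPT$ is the minimum of $\sum_j w_jC_j$ over all feasible schedules.
   Context: Scheduling model. A finite set $\mathcal{J}$ of $n$ jobs is to be processed without preemption on a single machine that processes at most one job at a time. Job $j$ has processing time $p_j>0$, weight $w_j>0$, and resource requirement $a_j\ge 0$ from a single non-renewable resource. The resource is supplied at $q\ge1$ known time points $0=u_1<u_2<\dots<u_q$, in quantities $\tilde b_1,\dots,\tilde b_q>0$. A schedule assigns a start time $S_j\ge 0$ to each job; job $j$ occupies the machine during $[S_j,S_j+p_j)$, and its completion time is $C_j=S_j+p_j$. A schedule is feasible if the jobs do not overlap on the machine and, for every time $t\ge0$, $\sum_{j: S_j\le t} a_j\le\sum_{\ell: u_\ell\le t}\tilde b_\ell$. It is assumed that the total requirement equals the total supply, $\sum_{j}a_j=\sum_{\ell=1}^q\tilde b_\ell$. The numerical data are rational numbers encoded in binary, with each job listed individually in the input. List scheduling in a given job order: the jobs are processed in exactly that order (ties in the order broken arbitrarily), each job being started as early as possible, i.e., at the earliest time that is not before the completion time of the preceding job in the order and at which the total supply received so far is at least the total requirement of this job and all jobs preceding it in the order.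 *)

(* Defs.v *)
From HB Require Import structures.
From mathcomp Require Import all_boot all_order all_algebra all_fingroup.
From mathcomp Require Import reals.

Set Implicit Arguments.
Unset Strict Implicit.
Unset Printing Implicit Defensive.
Import Order.TTheory GRing.Theory Num.Theory.
Local Open Scope ring_scope.

(** * Single machine scheduling with one non-renewable resource *)

Record instance := Instance {
  njobs : nat;
  nsupp : nat;
  proc : 'I_njobs -> rat;
  weight : 'I_njobs -> rat;
  req : 'I_njobs -> rat;
  supp_time : 'I_nsupp -> rat;
  supp_qty : 'I_nsupp -> rat }.

Record valid_instance (I : instance) : Prop := {
  proc_gt0 : forall j, 0 < proc (i := I) j;
  weight_gt0 : forall j, 0 < weight (i := I) j;
  req_ge0 : forall j, 0 <= req (i := I) j;
  nsupp_gt0 : (0 < nsupp I)%N;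
  supp_time0 : forall l, val l = 0%N -> supp_time (i := I) l = 0;
  supp_time_lt : forall l m : 'I_(nsupp I), (l < m)%N ->
    supp_time l < supp_time m;
  supp_qty_gt0 : forall l, 0 < supp_qty (i := I) l;
  req_total : \sum_j req (i := I) j = \sum_l supp_qty (i := I) l }.

(* The problem 1 | nr = 1, p_j = 1, w_j = a_j, q = 2 | sum_j w_j C_j. *)
Record unit_equal_two_supplies (I : instance) : Prop := {
  ue_valid : valid_instance I;
  ue_proc : forall j, proc (i := I) j = 1;
  ue_weight : forall j, weight (i := I) j = req (i := I) j;
  ue_nsupp : nsupp I = 2%N }.

Section Schedules.
Context {R : realType} (I : instance).
Implicit Types (S : 'I_(njobs I) -> R) (sigma : {perm 'I_(njobs I)}).

Definition completion S (j : 'I_(njobs I)) : R := S j + ratr (proc j).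

Definition supplied (t : R) : R :=
  \sum_(l < nsupp I | ratr (supp_time l) <= t) ratr (supp_qty l).

Record feasible S : Prop := {
  start_ge0 : forall j, 0 <= S j;
  no_overlap : forall t i j,
    S i <= t < completion S i -> S j <= t < completion S j -> i = j;
  resource_ok : forall t, 0 <= t ->
    \sum_(j < njobs I | S j <= t) ratr (req j) <= supplied t }.

Definition total_weighted_completion S : R :=
  \sum_(j < njobs I) ratr (weight j) * completion S j.

Definition is_optimum (opt : R) : Prop :=
  (exists2 S, feasible S & total_weighted_completion S = opt) /\
  (forall S, feasible S -> opt <= total_weighted_completion S).

(* A job order is a permutation: [sigma k] is the job in position [k]. *)
Definition nonincreasing_weight sigma : Prop :=
  forall i k : 'I_(njobs I), (i <= k)%N -> weight (sigma k) <= weight (sigma i).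

Definition may_start sigma S (k : 'I_(njobs I)) (t : R) : Prop :=
  [/\ 0 <= t,
      forall i : 'I_(njobs I), i.+1 = k :> nat -> completion S (sigma i) <= t
    & \sum_(i < njobs I | (i <= k)%N) ratr (req (sigma i)) <= supplied t].

Definition list_schedule sigma S : Prop :=
  forall k : 'I_(njobs I),
    may_start sigma S k (S (sigma k)) /\
    (forall t, may_start sigma S k t -> S (sigma k) <= t).

End Schedules.

(** * Polynomial time

  Programs compute with integers of unbounded size, stored in variables and
  arrays. The cost is logarithmic: every value that is computed, read or used
  as an array index is charged its bit length. Time polynomial in this model is
  time polynomial on a Turing machine. *)

Definition bits (z : int) : nat := (trunc_log 2 `|z|).+2.

Inductive expr :=
  | Const of int
  | Var of nat
  | Get of nat & expr (* [Get a e]: cell [e] of array [a] *)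
  | Add of expr & expr
  | Sub of expr & expr
  | Mul of expr & expr.

Inductive cmd :=
  | Skip
  | Assign of nat & expr
  | Put of nat & expr & expr (* [Put a e f]: store [f] in cell [e] of [a] *)
  | Seq of cmd & cmd
  | IfPos of expr & cmd & cmd
  | WhilePos of expr & cmd.

Record state := State {
  var : nat -> int;
  arr : nat -> nat -> int }.

Fixpoint eval (s : state) (e : expr) : int :=
  match e with
  | Const z => z
  | Var x => var s x
  | Get a e1 => arr s a `|eval s e1|%N
  | Add e1 e2 => eval s e1 + eval s e2
  | Sub e1 e2 => eval s e1 - eval s e2
  | Mul e1 e2 => eval s e1 * eval s e2
  end.

Fixpoint cost (s : state) (e : expr) : nat :=
  (bits (eval s e) +
   match e with
   | Const _ | Var _ => 0
   | Get _ e1 => cost s e1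
   | Add e1 e2 | Sub e1 e2 | Mul e1 e2 => cost s e1 + cost s e2
   end)%N.

Definition set_var (s : state) (x : nat) (z : int) : state :=
  State (fun y => if y == x then z else var s y) (arr s).

Definition set_cell (s : state) (a i : nat) (z : int) : state :=
  State (var s)
    (fun b j => if (b == a) && (j == i) then z else arr s b j).

(* [exec c s T s']: run from [s], [c] halts in [s'] after time [T]. *)
Inductive exec : cmd -> state -> nat -> state -> Prop :=
  | ExecSkip s : exec Skip s 1 s
  | ExecAssign s x e :
      exec (Assign x e) s (cost s e).+1 (set_var s x (eval s e))
  | ExecPut s a e f :
      exec (Put a e f) s (cost s e + cost s f).+1
        (set_cell s a `|eval s e|%N (eval s f))
  | ExecSeq c d s T s' U s'' :
      exec c s T s' -> exec d s' U s'' -> exec (Seq c d) s (T + U).+1 s''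
  | ExecIfTrue e c d s T s' : 0 < eval s e ->
      exec c s T s' -> exec (IfPos e c d) s (cost s e + T).+1 s'
  | ExecIfFalse e c d s T s' : eval s e <= 0 ->
      exec d s T s' -> exec (IfPos e c d) s (cost s e + T).+1 s'
  | ExecWhileTrue e c s T s' U s'' : 0 < eval s e ->
      exec c s T s' -> exec (WhilePos e c) s' U s'' ->
      exec (WhilePos e c) s (cost s e + T + U).+1 s''
  | ExecWhileFalse e c s : eval s e <= 0 ->
      exec (WhilePos e c) s (cost s e).+1 s.

Definition encode_rat (x : rat) : seq int := [:: numq x; denq x].

Definition encode (I : instance) : seq int :=
  [:: Posz (njobs I); Posz (nsupp I)] ++
  flatten [seq encode_rat (proc j) ++ encode_rat (weight j) ++
               encode_rat (req j) | j <- enum 'I_(njobs I)] ++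
  flatten [seq encode_rat (supp_time l) ++ encode_rat (supp_qty l)
          | l <- enum 'I_(nsupp I)].

Definition input_size (I : instance) : nat := sumn [seq bits z | z <- encode I].

(* The input is array 0; everything else is initially zero. *)
Definition init (I : instance) : state :=
  State (fun _ => 0)
    (fun a i => if a == 0%N then nth 0 (encode I) i else 0).

(* The start time of job [j] is output as a fraction: its numerator and its
   denominator are in cells [2j] and [2j + 1] of array 1. *)
Definition outputs (R : realType) (I : instance) (s : state)
    (S : 'I_(njobs I) -> R) : Prop :=
  forall j : 'I_(njobs I),
    arr s 1 j.*2.+1 != 0 /\
    S j = (arr s 1 j.*2)%:~R / (arr s 1 j.*2.+1)%:~R.

(* [alg I S]: [S] is a possible result on [I] (the algorithm may leave choices,
   such as tie-breaking, open). Some implementation must run in polynomial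
   time. As [input_size I >= 2], every polynomial bound has the form below. *)
Definition polynomial_time (R : realType) (P : instance -> Prop)
    (alg : forall I : instance, ('I_(njobs I) -> R) -> Prop) : Prop :=
  exists (prog : cmd) (c d : nat), forall I : instance, P I ->
    exists (T : nat) (s : state) (S : 'I_(njobs I) -> R),
      [/\ exec prog (init I) T s, (T <= c * input_size I ^ d)%N,
          outputs s S & alg I S].

(* Main.v *)
Require Import Defs.
From HB Require Import structures.
From mathcomp Require Import all_boot all_order all_algebra all_fingroup.
From mathcomp Require Import boolp reals.
From mathcomp Require Import zify ring lra.

Set Implicit Arguments.
Unset Strict Implicit.
Unset Printing Implicit Defensive.
Import Order.TTheory GRing.Theory Num.Theory.
Local Open Scope ring_scope.

(* Let [u] be the second supply time. In the list schedule the job in position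
   [k] (from 0) starts at [k] plus, if its prefix exceeds the first supply, an
   idle time of at most [u]. The cost is thus at most [sum_k w_k (k + 1) + u D],
   where [D] is the weight of the late jobs. In any feasible schedule let [X] be
   the weight of the jobs started from [u] on. Then [D <= 2 X]; and subtracting
   [u] from the start of these jobs leaves a schedule on two parallel machines,
   whose cost is at least half of the sorted cost [sum_k w_k (k + 1)] on one
   machine. Adding up gives the factor 2.

   For the running time, the position of a job is found by counting its
   predecessors, and the prefix sums are accumulated as unreduced fractions,
   whose bit length stays quadratic in the input size. *)

(** * List scheduling *)

(** By pigeonhole, [n + 1] distinct naturals include one that is at least [n]; removing it leaves
    [n] distinct naturals for the induction. *)
Lemma sumn_uniq_ge (s : seq nat) :
  uniq s -> (\sum_(k < size s) k <= \sum_(x <- s) x)%N.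
Proof.
move En: (size s) => n.
elim: n s En => [|n IHn] s sz us; first by rewrite big_ord0.
have [x xs nx] : exists2 x, x \in s & (n <= x)%N.
  apply/hasP; apply/negPn/negP => /hasPn H.
  have: {subset s <= iota 0 n}.
    by move=> x /H; rewrite mem_iota -ltnNge.
  by move/(uniq_leq_size us); rewrite size_iota sz ltnn.
rewrite (perm_big _ (perm_to_rem xs)) big_cons big_ord_recr /= addnC.
apply: leq_add => //; apply: IHn (rem_uniq _ us).
by rewrite size_rem // sz.
Qed.

(** Summation by parts, done inductively: partial sums of [e] are nonnegative, so lowering their
    coefficient from one value of [v] to the next can only decrease the product. For [n = 0] both
    sums are empty. *)
Lemma abel_sum_ge (R : numDomainType) (v e : nat -> R) n :
  (forall k, (k.+1 < n)%N -> v k.+1 <= v k) ->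
  (forall m, (m <= n)%N -> 0 <= \sum_(k < m) e k) ->
  v n.-1 * \sum_(k < n) e k <= \sum_(k < n) v k * e k.
Proof.
elim: n => [|n IHn] vd e0; first by rewrite !big_ord0 mulr0.
rewrite !big_ord_recr /= mulrDr lerD2r.
apply: le_trans (IHn _ _); last 2 first.
- by move=> k kn; apply: vd; rewrite ltnW.
- by move=> m mn; apply: e0; rewrite ltnW.
case: n vd e0 {IHn} => [|n] vd e0; first by rewrite !big_ord0 !mulr0.
by apply: ler_wpM2r; [exact: e0 | exact: vd].
Qed.

(** A rearrangement inequality for distinct positions that may leave gaps: the differences [p k - k]
    have nonnegative partial sums by [sumn_uniq_ge], so [abel_sum_ge] applies to them. *)
Lemma rearrangement_inj (R : numDomainType) n (v : 'I_n -> R) (p : 'I_n -> nat) :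
  injective p -> (forall i k : 'I_n, (i <= k)%N -> v k <= v i) ->
  (forall k, 0 <= v k) ->
  \sum_k v k * k%:R <= \sum_k v k * (p k)%:R.
Proof.
case: n v p => [|n] v p pI vd v0; first by rewrite !big_ord0.
rewrite -subr_ge0 -sumrB.
pose e (k : nat) : R := (p (inord k))%:R - k%:R.
have e0 m : (m <= n.+1)%N -> 0 <= \sum_(k < m) e k.
  move=> mn; rewrite sumrB -!natr_sum subr_ge0 ler_nat.
  have := @sumn_uniq_ge [seq p (inord k) | k <- iota 0 m].
  rewrite size_map size_iota big_map.
  have -> : (\sum_(k <- iota 0 m) p (inord k) = \sum_(k < m) p (inord k))%N.
    by rewrite -(big_mkord xpredT (fun k => p (inord k))) /index_iota subn0.
  apply; rewrite map_inj_in_uniq ?iota_uniq // => i k.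
  rewrite !mem_iota /= !add0n => im km /pI /(congr1 val).
  by rewrite /= !inordK // (leq_trans _ mn).
have vd' k : (k.+1 < n.+1)%N -> v (inord k.+1) <= v (inord k).
  by move=> kn; apply: vd; rewrite !inordK // ltnW.
have := abel_sum_ge (v := fun k => v (inord k)) vd' e0.
rewrite [leRHS](eq_bigr (fun i => v i * (p i)%:R - v i * i%:R)) => [|i _]; last first.
  by rewrite /e inord_val mulrBr.
by apply: le_trans; rewrite mulr_ge0 // e0.
Qed.

Lemma card_ord_lt n (k : 'I_n) : #|[pred i : 'I_n | (i < k)%N]| = k.
Proof.
rewrite -sum1_card -[RHS]card_ord -sum1_card.
by rewrite (big_ord_widen _ (fun=> 1%N) (ltnW (ltn_ord k))); apply: eq_bigl.
Qed.

Lemma sorting_perm (R : realDomainType) n (f : 'I_n -> R) :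
  exists s : {perm 'I_n}, forall i k : 'I_n, (i <= k)%N -> f (s i) <= f (s k).
Proof.
pose r i j := f i <= f j.
pose t := sort_tuple r (ord_tuple n).
have /tuple_permP[s st] : perm_eq t (ord_tuple n) by rewrite perm_sort.
have tE k : tnth t k = s k.
  by rewrite (tnth_nth k) st -(tnth_nth k [tuple _ | i < n]) tnth_mktuple tnth_ord_tuple.
exists s => i k ik; rewrite -!tE.
have rt : transitive r by move=> ? ? ?; apply: le_trans.
have so : sorted r t by apply: sort_sorted => x y; apply: le_total.
rewrite !(tnth_nth i); apply: (sorted_leq_nth rt _ _ so) => //.
- by move=> x; exact: lexx.
- by rewrite inE size_tuple.
- by rewrite inE size_tuple.
Qed.

(** * List schedules of unit jobs under two supplies: feasibility, optimum, approximation *)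

Section ListScheduling.
Context {R : realType} (I : instance) (u b1 b2 : rat).
Implicit Types (S : 'I_(njobs I) -> R) (sigma : {perm 'I_(njobs I)}).

Hypothesis proc1 : forall j : 'I_(njobs I), proc j = 1.
Hypothesis req_gt0 : forall j : 'I_(njobs I), 0 < req j.
Hypothesis weight_req : forall j : 'I_(njobs I), weight j = req j.
Hypothesis u_gt0 : 0 < u.
Hypothesis b1_gt0 : 0 < b1.
Hypothesis b2_gt0 : 0 < b2.
Hypothesis req_sum : \sum_j req (i := I) j = b1 + b2.
Hypothesis suppliedE : forall t : R, 0 <= t ->
  supplied I t = ratr b1 + (if ratr u <= t then ratr b2 else 0).

Definition prefix_req sigma (k : 'I_(njobs I)) : rat :=
  \sum_(i < njobs I | (i <= k)%N) req (sigma i).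

Definition late sigma (k : 'I_(njobs I)) : bool := b1 < prefix_req sigma k.

(** Early jobs fill the machine without gaps up to the number of early positions. This is the wait
    from then until [u], zero if [u] has already passed. *)
Definition idle sigma : R :=
  Num.max 0 (ratr u - #|[pred k | ~~ late sigma k]|%:R).

Definition list_start sigma (j : 'I_(njobs I)) : R :=
  let k := (sigma^-1)%g j in k%:R + (if late sigma k then idle sigma else 0).

Lemma completionE S j : completion S j = S j + 1.
Proof. by rewrite /completion proc1 rmorph1. Qed.

Lemma prefix_req_homo sigma (i k : 'I_(njobs I)) :
  (i <= k)%N -> prefix_req sigma i <= prefix_req sigma k.
Proof.
move=> ik; rewrite /prefix_req [leRHS](bigID (fun l : 'I_(njobs I) => (l <= i)%N)) /=.
rewrite -[leLHS]addr0 lerD //; last by apply: sumr_ge0 => l _; exact: ltW.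
rewrite (eq_bigl (fun l : 'I_(njobs I) => (l <= k)%N && (l <= i)%N)) // => l.
by case: (leqP l i) => [li|]; rewrite ?andbF // (leq_trans li ik).
Qed.

Lemma late_homo sigma (i k : 'I_(njobs I)) :
  (i <= k)%N -> late sigma i -> late sigma k.
Proof. by move=> ik /lt_le_trans; apply; exact: prefix_req_homo. Qed.

(** From [u] on, the supply is the total requirement and covers every prefix; before [u] it is [b1],
    which covers exactly the early ones. *)
Lemma prefix_req_le_supplied sigma (k : 'I_(njobs I)) (t : R) : 0 <= t ->
  (\sum_(i < njobs I | (i <= k)%N) ratr (req (sigma i)) <= supplied I t) =
  (late sigma k ==> (ratr u <= t)).
Proof.
move=> t0; rewrite suppliedE // -rmorph_sum -/(prefix_req sigma k) /late.
case: (ltP b1 (prefix_req sigma k)) => /= h; case: (leP (ratr u) t) => /= _.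
- rewrite -rmorphD ler_rat -req_sum (reindex_inj (@perm_inj _ sigma)).
  rewrite /prefix_req big_mkcond /= ler_sum // => i _.
  by case: ifP => // _; exact: ltW.
- by rewrite addr0 ler_rat leNgt h.
- by rewrite -rmorphD ler_rat (le_trans h) // lerDl ltW.
- by rewrite addr0 ler_rat h.
Qed.

Lemma idle_ge0 sigma : 0 <= idle sigma.
Proof. by rewrite /idle le_max lexx. Qed.

(** Lateness is monotone in the position, so the early positions form an initial segment. This lemma
    and the next locate its end. *)
Lemma card_early_le sigma (k : 'I_(njobs I)) : late sigma k ->
  (#|[pred i | ~~ late sigma i]| <= k)%N.
Proof.
move=> lk; rewrite -(card_ord_lt k).
apply: subset_leq_card; apply/subsetP => i; rewrite !inE ltnNge.
by apply: contra => /late_homo; apply.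
Qed.

Lemma card_early_ge sigma (k : 'I_(njobs I)) :
  (forall i : 'I_(njobs I), (i < k)%N -> ~~ late sigma i) ->
  (k <= #|[pred i | ~~ late sigma i]|)%N.
Proof.
move=> lk; rewrite -(card_ord_lt k).
by apply: subset_leq_card; apply/subsetP => i; rewrite !inE; apply: lk.
Qed.

Lemma list_start_perm sigma k :
  list_start sigma (sigma k) =
  k%:R + (if late sigma k then idle sigma else 0).
Proof. by rewrite /list_start permK. Qed.

Lemma list_startP sigma : list_schedule sigma (list_start sigma).
Proof.
move=> k; split.
- split.
  + rewrite list_start_perm addr_ge0 //; case: ifP => // _; exact: idle_ge0.
  + move=> i ik; rewrite completionE !list_start_perm -ik -natr1.
    have : (i <= k)%N by rewrite -ik.
    move/(@late_homo sigma); case: (late sigma i) => [-> //|_]; first by lra.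
    by case: ifP => _; have := idle_ge0 sigma; lra.
  + rewrite prefix_req_le_supplied; last first.
      rewrite list_start_perm addr_ge0 //; case: ifP => // _; exact: idle_ge0.
    apply/implyP => lk; rewrite list_start_perm lk.
    have := card_early_le lk; rewrite -(ler_nat R) => h.
    have : ratr u - #|[pred k0 | ~~ late sigma k0]|%:R <= idle sigma.
      by rewrite /idle le_max lexx orbT.
    by move: h; lra.
- move=> t [t0 prev]; rewrite prefix_req_le_supplied // list_start_perm => ut.
  case: (posnP k) => [k0|k_gt0].
    rewrite k0 add0r; case: ifP => // lk; rewrite /idle ge_max t0.
    by move: ut; rewrite lk /= => ut; rewrite (le_trans _ ut) // gerBl.
  have kn : (k.-1 < njobs I)%N by rewrite prednK // ltnW.
  have kE : (Ordinal kn).+1 = k by rewrite /= prednK.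
  have := prev _ kE; rewrite completionE list_start_perm -{3}kE -natr1.
  case: (boolP (late sigma (Ordinal kn))) => li.
    by rewrite (late_homo _ li) ?kE ?leq_pred //=; lra.
  case: ifP => [lk|_]; last by rewrite addrAC.
  move: ut; rewrite lk addr0 natr1 kE /= => ut kt.
  (* Here [k] is late and its predecessor early, so all positions before [k] are early; with
     [k <= t] and [u <= t] this bounds [idle] by [t - k]. *)
  have mk : (k <= #|[pred i | ~~ late sigma i]|)%N.
    apply: card_early_ge => i ik; apply: contra li; apply: late_homo.
    by rewrite -ltnS kE.
  move: mk; rewrite -(ler_nat R) /idle => mk.
  by rewrite -lerBrDl ge_max; apply/andP; split; lra.
Qed.


(** Induction on the distance of the two positions, since [may_start] relates only consecutive
    ones. *)
Lemma sorted_list_schedule sigma S (i k : 'I_(njobs I)) :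
  list_schedule sigma S -> (i < k)%N -> S (sigma i) + 1 <= S (sigma k).
Proof.
move=> LS.
have H m : forall i k : 'I_(njobs I), k = (i.+1 + m)%N :> nat ->
    S (sigma i) + 1 <= S (sigma k).
  elim: m => [|m IHm] {}i {}k km.
    have [[_ prev _] _] := LS k; rewrite -completionE; apply: prev.
    by rewrite km addn0.
  have kn : (i.+1 + m < njobs I)%N by rewrite (leq_trans _ (ltnW (ltn_ord k))) // km addnS.
  apply: le_trans (IHm i (Ordinal kn) erefl) _.
  have [[_ prev _] _] := LS k; apply: le_trans (prev (Ordinal kn) _).
    by rewrite completionE lerDl.
  by rewrite km /= addnS.
by move=> ik; apply: (H (k - i.+1)%N); rewrite subnKC.
Qed.

Lemma list_schedule_feasible sigma S : list_schedule sigma S -> feasible S.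
Proof.
move=> LS; split.
- move=> j; rewrite -(permKV sigma j).
  by have [[]] := LS ((sigma^-1)%g j).
- move=> t i j; rewrite !completionE -(permKV sigma i) -(permKV sigma j).
  set i' := (_ i); set k' := (_ j) => /andP[it ti] /andP[jt tj].
  congr (sigma _); apply: val_inj => /=; case: (ltngtP i' k') => //;
    by move/(sorted_list_schedule LS) => h; exfalso; lra.
- move=> t t0; rewrite (reindex_inj (@perm_inj _ sigma)) /=.
  have [[k0 k0t]|nok] := pselect (exists k, S (sigma k) <= t); last first.
    rewrite big1; last by move=> k kt; case: nok; exists k.
    by rewrite suppliedE // addr_ge0 //; [|case: ifP => // _]; rewrite ler0q ltW.
  (* Start times increase along the order, so the jobs started by [t] form the prefix ending at the
     last such position [k], whose own start condition bounds the sum. *)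
  case: (@arg_maxnP _ k0 (fun k => S (sigma k) <= t) (fun k => k : nat) k0t) => k kt kmax.
  have [[Sk0 _ Sk] _] := LS k.
  rewrite (eq_bigl (fun i : 'I_(njobs I) => (i <= k)%N)).
    apply: (le_trans Sk); rewrite !suppliedE //.
    rewrite lerD2l; case: ifP => [h|_]; first by rewrite (le_trans h kt).
    by case: ifP => // _; rewrite ler0q ltW.
  move=> i; apply/idP/idP => [/kmax//|]; rewrite leq_eqVlt => /orP[/eqP/val_inj ->//|].
  by move/(sorted_list_schedule LS); move: kt; lra.
Qed.

Lemma feasible_dist S i j : feasible S -> i != j -> S i <= S j -> S i + 1 <= S j.
Proof.
move=> [_ no _] ij Sij; rewrite leNgt; apply: contra ij => h.
by apply/eqP/(no (S j)); rewrite completionE ?h ?Sij ?lexx //= ltrDl.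
Qed.

(** If [sigma] sorts the jobs by their start in [S], then inductively each start in [S] is an
    admissible start in the list schedule: the predecessor has finished, and the prefix has been
    paid for since all of it has started. *)
Lemma list_schedule_le sigma S L : feasible S -> list_schedule sigma L ->
  (forall i k : 'I_(njobs I), (i <= k)%N -> S (sigma i) <= S (sigma k)) ->
  forall j, L j <= S j.
Proof.
move=> fS LS srt; have [S0 _ res] := fS.
have sup (k : 'I_(njobs I)) :
    \sum_(i < njobs I | (i <= k)%N) ratr (req (sigma i)) <=
    supplied I (S (sigma k)).
  apply: le_trans (res _ (S0 _)).
  rewrite [leRHS](reindex_inj (@perm_inj _ sigma)) /=.
  rewrite big_mkcond [leRHS]big_mkcond ler_sum // => i _.
  case: ifP => h; first by rewrite srt.
  by case: ifP => // _; rewrite ler0q ltW.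
suff le_S k (kn : (k < njobs I)%N) : L (sigma (Ordinal kn)) <= S (sigma (Ordinal kn)).
  by move=> j; rewrite -(permKV sigma j); case: (_ j).
elim: k kn => [|k IHk] kn; have [_ minL] := LS (Ordinal kn); apply: minL; split=> //.
move=> i [ik]; have kn' := ltnW kn.
rewrite completionE; have -> : i = Ordinal kn' by exact: val_inj.
apply: le_trans (_ : S (sigma (Ordinal kn')) + 1 <= _); first by rewrite lerD2r.
apply: feasible_dist => //; last by apply: srt; exact: leqnSn.
by rewrite (inj_eq perm_inj) -(inj_eq val_inj) /= ltn_eqF.
Qed.

(** Every feasible schedule is dominated by the list schedule in its own start order, so a minimum
    over the finitely many permutations is a minimum over all schedules. *)
Lemma optimum_exists : exists opt : R, is_optimum I opt.
Proof.
case: (@arg_minP _ _ _ (1%g : {perm 'I_(njobs I)}) xpredT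
  (fun sigma => total_weighted_completion (list_start sigma)) isT) => sigma _ smin.
exists (total_weighted_completion (list_start sigma)); split.
  by exists (list_start sigma) => //; apply: list_schedule_feasible (list_startP sigma).
move=> S fS; have [tau tS] := sorting_perm S.
apply: le_trans (smin tau isT) _; apply: ler_sum => j _.
apply: ler_wpM2l; first by rewrite ler0q weight_req ltW.
rewrite !completionE lerD2r.
exact: list_schedule_le fS (list_startP tau) tS j.
Qed.

(** A list schedule is feasible and sorted along its own order. With the roles exchanged this gives
    equality, so bounds on [list_start] transfer to any list schedule. *)
Lemma list_schedule_uniq sigma S L :
  list_schedule sigma S -> list_schedule sigma L -> forall j, L j <= S j.
Proof.
move=> LS LL; apply: list_schedule_le (list_schedule_feasible LS) LL _.
move=> i k; rewrite leq_eqVlt => /orP[/eqP/val_inj ->//|].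
by move/(sorted_list_schedule LS); lra.
Qed.

(* Let [m] be the first late position. What follows [m] weighs less than [b2],
   hence less than the jobs that [S] starts after [u]; the latter therefore
   include a job at a position up to [m], which is at least as heavy as [m]. *)
Lemma late_req_le S sigma : feasible S -> nonincreasing_weight sigma ->
  \sum_(k | late sigma k) ratr (req (sigma k)) <=
  2 * \sum_(j | ratr u <= S j) ratr (req j) :> R.
Proof.
move=> fS wd; set X := \sum_(j | ratr u <= S j) _.
have a0 (j : 'I_(njobs I)) : 0 <= ratr (req j) :> R by rewrite ler0q ltW.
have totR : \sum_(j < njobs I) ratr (req j) = ratr b1 + ratr b2 :> R.
  by rewrite -rmorph_sum req_sum rmorphD.
have X0 : 0 <= X by rewrite sumr_ge0.
have X2 : ratr b2 <= X.
  suff : \sum_(j | ~~ (ratr u <= S j)) ratr (req j) <= ratr b1 :> R.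
    by move: totR; rewrite (bigID (fun j => ratr u <= S j)) /= -/X; lra.
  have [[j0 j0u]|nok] := pselect (exists j, ~~ (ratr u <= S j)); last first.
    rewrite big1; last by move=> k kt; case: nok; exists k.
    by rewrite ler0q ltW.
  (* At the last start before [u], all jobs started before [u] have drawn on [b1] alone. *)
  case: (@arg_maxP _ _ _ j0 (fun j => ~~ (ratr u <= S j)) S j0u) => j ju jmax.
  have [S0 _ res] := fS; have := res _ (S0 j).
  rewrite suppliedE // (negbTE ju) addr0; apply: le_trans.
  rewrite big_mkcond [leRHS]big_mkcond ler_sum // => i _.
  case: ifP => [/jmax h|_]; last by case: ifP.
  by rewrite (h : S i <= S j).
have [[k0 k0l]|nok] := pselect (exists k, late sigma k); last first.
  rewrite big1; first by rewrite mulr_ge0.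
  by move=> k kt; case: nok; exists k.
case: (@arg_minnP _ k0 (late sigma) (fun k => k : nat) k0l) => m ml mmin.
have rest : \sum_(k < njobs I | (m < k)%N) ratr (req (sigma k)) < ratr b2 :> R.
  move: ml; rewrite /late -(ltr_rat R) rmorph_sum /=.
  move: totR; rewrite (reindex_inj (@perm_inj _ sigma)) /=.
  rewrite (bigID (fun k : 'I_(njobs I) => (k <= m)%N)) /=.
  rewrite (eq_bigl (fun k : 'I_(njobs I) => (m < k)%N) _ (fun k => esym (ltnNge _ _))).
  by lra.
have -> : \sum_(k | late sigma k) ratr (req (sigma k)) =
    ratr (req (sigma m)) + \sum_(k < njobs I | (m < k)%N) ratr (req (sigma k)) :> R.
  rewrite (bigD1 m) //=; congr (_ + _); apply: eq_bigl => k.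
  rewrite ltn_neqAle eq_sym; apply/andP/andP => -[].
    by move=> /mmin /= -> /negP h; split=> //; apply/negP => /eqP /val_inj /eqP.
  move=> km mk; split; first exact: late_homo ml.
  by apply: contra km => /eqP ->.
suff : ratr (req (sigma m)) <= X by move: rest; lra.
have [[k /andP[km ku]]|nok] :=
    pselect (exists k : 'I_(njobs I), (k <= m)%N && (ratr u <= S (sigma k))).
  rewrite /X (bigD1 (sigma k)) //=.
  apply: ler_wpDr; first by rewrite sumr_ge0.
  by rewrite ler_rat -!weight_req wd.
(* Otherwise all jobs started from [u] on lie after [m], so [X] would be less than [b2]. *)
suff : X <= \sum_(k < njobs I | (m < k)%N) ratr (req (sigma k)) by move: rest X2; lra.
rewrite /X (reindex_inj (@perm_inj _ sigma)) /=.
rewrite big_mkcond [leRHS]big_mkcond ler_sum // => k _.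
case: ifP => ku; last by case: ifP.
case: ltnP => // km; case: nok; exists k; by rewrite km.
Qed.

(* Jobs started before and after [u] are seen as run on two machines in
   parallel, by moving the latter to start at time [- u]. Giving even positions
   to the first machine and odd ones to the second compares this to the
   uninterrupted sorted sequence. *)
Lemma positions_le S sigma : feasible S -> nonincreasing_weight sigma ->
  \sum_(k < njobs I) ratr (req (sigma k)) * (k%:R + 1) <=
  2 * \sum_(j < njobs I)
    ratr (req j) * (S j - (if ratr u <= S j then ratr u else 0) + 1) :> R.
Proof.
move=> fS wd; have [S0 _ _] := fS.
have a0 (j : 'I_(njobs I)) : 0 <= ratr (req j) :> R by rewrite ler0q ltW.
pose l j := ratr u <= S j.
pose s j := S j - (if l j then ratr u else 0).
have s0 j : 0 <= s j by rewrite /s; case: ifP; rewrite ?subr0 // subr_ge0.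
(* Parity encodes the machine, the floor of the shifted start its slot. Jobs on one machine start at
   least 1 apart, so their floors differ. *)
pose p j := ((Num.truncn (s j)).*2 + l j)%N.
have pI : injective p.
  move=> i j pij; have lij : l i = l j.
    by have /(congr1 odd) := pij; rewrite !oddD !odd_double !oddb.
  have tij : Num.truncn (s i) = Num.truncn (s j).
    by move: pij; rewrite /p lij => /addIn /double_inj.
  apply/eqP; apply: contraT => ij.
  have /andP[] := truncn_itv (s0 i); have /andP[] := truncn_itv (s0 j).
  rewrite tij -natr1 /s lij.
  case: (leP (S i) (S j)) => [h|/ltW h].
    by have := feasible_dist fS ij h; lra.
  by rewrite eq_sym in ij; have := feasible_dist fS ij h; lra.
have wd' (i k : 'I_(njobs I)) : (i <= k)%N ->
    ratr (req (sigma k)) <= ratr (req (sigma i)) :> R.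
  by move=> ik; rewrite ler_rat -!weight_req wd.
have := rearrangement_inj (inj_comp pI (@perm_inj _ sigma)) wd' (fun k => a0 (sigma k)).
have reE (f : 'I_(njobs I) -> R) : \sum_k f (sigma k) = \sum_j f j.
  by rewrite [RHS](reindex_inj (@perm_inj _ sigma)).
rewrite (reE (fun j => ratr (req j) * (p j)%:R)) => h.
rewrite mulr_sumr; under eq_bigr do rewrite mulrDr mulr1.
rewrite big_split /= (reE (fun j => ratr (req j))).
apply: le_trans (_ : \sum_j ratr (req j) * ((p j)%:R + 1) <= _).
  by under [leRHS]eq_bigr do rewrite mulrDr mulr1; rewrite big_split /= lerD2r.
(* The factor 2 arises here: [p j + 1] is at most [2 * s j + 2], the machine bit being at most 1. *)
apply: ler_sum => j _; rewrite mulrCA ler_wpM2l // /p natrD -muln2 natrM.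
have /andP[ts _] := truncn_itv (s0 j); rewrite -/(s j).
have : (l j)%:R <= 1 :> R by case: (l j).
by lra.
Qed.

Lemma list_schedule_approx S L sigma : feasible S -> nonincreasing_weight sigma ->
  list_schedule sigma L ->
  total_weighted_completion L <= 2 * total_weighted_completion S.
Proof.
move=> fS wd LL.
have a0 (j : 'I_(njobs I)) : 0 <= ratr (req j) :> R by rewrite ler0q ltW.
have u0 : 0 <= ratr u :> R by rewrite ler0q ltW.
(* The cost of [S] splits exactly into the shifted cost in [positions_le] and [u] times the weight
   in [late_req_le]. *)
have -> : total_weighted_completion S =
    \sum_j ratr (req j) * (S j - (if ratr u <= S j then ratr u else 0) + 1) +
    (\sum_(j | ratr u <= S j) ratr (req j)) * ratr u.
  rewrite mulr_suml [X in _ + X]big_mkcond -big_split; apply: eq_bigr => j _ /=.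
  by rewrite completionE weight_req; case: ifP => _; lra.
have := positions_le fS wd; have := late_req_le fS wd.
move/(ler_wpM2r u0); rewrite -(mulrA 2) => h1 h2.
rewrite mulrDr; apply: le_trans (lerD h2 h1).
rewrite mulr_suml [X in _ + X]big_mkcond -big_split /total_weighted_completion.
rewrite (reindex_inj (@perm_inj _ sigma)) /=; apply: ler_sum => k _.
rewrite completionE weight_req.
have : L (sigma k) <= k%:R + (if late sigma k then ratr u else 0).
  apply: le_trans (list_schedule_uniq (list_startP sigma) LL _) _.
  rewrite list_start_perm lerD2l; case: ifP => // _.
  by rewrite /idle ge_max u0 gerBl ler0n.
by move/(ler_wpM2l (a0 (sigma k))); case: ifP => _; lra.
Qed.
End ListScheduling.

(** * Execution time of programs *)

Section Timing.
Implicit Types (s : state) (e : expr) (c d : cmd) (z : int) (Q : state -> Prop).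

Definition bounded (M : nat) s : Prop :=
  (forall x, (`|var s x| <= 2 ^ M)%N) /\ (forall a i, (`|arr s a i| <= 2 ^ M)%N).

(* Weighted size such that values from an [M]-bounded state have at most
   [M * esize e] bits. *)
Fixpoint esize e : nat :=
  match e with
  | Const z => bits z
  | Var _ => 1
  | Get _ e1 => (esize e1).+1
  | Add e1 e2 | Defs.Sub e1 e2 | Mul e1 e2 => (esize e1 + esize e2).+1
  end.

Lemma bits_le z M : (`|z| <= 2 ^ M)%N -> (bits z <= M.+2)%N.
Proof.
move=> zM; rewrite /bits !ltnS; have := leq_trunc_log 2 zM.
by rewrite trunc_expnK.
Qed.

Lemma absz_lt_bits z : (`|z| < 2 ^ (bits z).-1)%N.
Proof. exact: trunc_log_ltn. Qed.

Lemma esize_gt0 e : (0 < esize e)%N. Proof. by case: e. Qed.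

Lemma leq_2exp2 (a b c : nat) : (a <= b)%N -> (c <= 2 ^ a)%N -> (c <= 2 ^ b)%N.
Proof. by move=> ab ca; rewrite (leq_trans ca) // leq_exp2l. Qed.

(** Positive exponents make the product of the two powers at least their sum, so sums and products
    obey the same bit bound. *)
Lemma leq_add_exp2 x y a b : (0 < a)%N -> (0 < b)%N ->
  (x <= 2 ^ a)%N -> (y <= 2 ^ b)%N -> (x + y <= 2 ^ (a + b))%N.
Proof.
move=> a0 b0 xa yb; rewrite (leq_trans (leq_add xa yb)) // expnD.
by move: a b a0 b0 {xa yb} => [|a] [|b] // _ _; rewrite !expnS; nia.
Qed.

Lemma eval_bounded M s e : (0 < M)%N -> bounded M s ->
  (`|eval s e| <= 2 ^ (M * esize e))%N.
Proof.
move=> M0 [vb ab]; have ep e' : (0 < M * esize e')%N by rewrite muln_gt0 M0 esize_gt0.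
elim: e => [z|x|a e _|e1 IH1 e2 IH2|e1 IH1 e2 IH2|e1 IH1 e2 IH2] /=.
- apply: leq_2exp2 (ltnW (absz_lt_bits z)).
  by rewrite (leq_trans (leq_pred _)) // leq_pmull.
- by rewrite muln1.
- by apply: leq_2exp2 (ab a _); rewrite leq_pmulr.
- apply: (@leq_2exp2 (M * esize e1 + M * esize e2)); first by rewrite -mulnDr leq_mul.
  apply: leq_trans (leq_add_exp2 _ _ IH1 IH2) => //; lia.
- apply: (@leq_2exp2 (M * esize e1 + M * esize e2)); first by rewrite -mulnDr leq_mul.
  apply: leq_trans (leq_add_exp2 _ _ IH1 IH2) => //; lia.
- apply: (@leq_2exp2 (M * esize e1 + M * esize e2)); first by rewrite -mulnDr leq_mul.
  by rewrite abszM expnD leq_mul.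
Qed.

(** At most [esize e] subexpressions are charged, each at most [M * esize e + 2] bits; for positive
    [M] the latter is at most [3 * M * esize e]. *)
Definition eunits e : nat := 3 * esize e ^ 2.

Lemma cost_bounded M s e : (0 < M)%N -> bounded M s ->
  (cost s e <= eunits e * M)%N.
Proof.
move=> M0 bs.
have bE e' : (bits (eval s e') <= 3 * esize e' * M)%N.
  apply: (leq_trans (bits_le (eval_bounded e' M0 bs))).
  by have := esize_gt0 e'; nia.
rewrite /eunits; elim: e => [z|x|a e IH|e1 IH1 e2 IH2|e1 IH1 e2 IH2|e1 IH1 e2 IH2].
- rewrite /= addn0; apply: leq_trans (bE (Const z)) _.
  by have := esize_gt0 (Const z); rewrite /=; nia.
- by rewrite /= addn0; apply: leq_trans (bE (Var x)) _.
- rewrite [cost _ _]/=; apply: leq_trans (leq_add (bE (Get a e)) IH) _.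
  by rewrite /=; nia.
- rewrite [cost _ _]/=; apply: leq_trans (leq_add (bE (Add e1 e2)) (leq_add IH1 IH2)) _.
  by rewrite /=; nia.
- rewrite [cost _ _]/=; apply: leq_trans (leq_add (bE (Defs.Sub e1 e2)) (leq_add IH1 IH2)) _.
  by rewrite /=; nia.
- rewrite [cost _ _]/=; apply: leq_trans (leq_add (bE (Mul e1 e2)) (leq_add IH1 IH2)) _.
  by rewrite /=; nia.
Qed.

Fixpoint loopfree c : bool :=
  match c with
  | Seq c d | IfPos _ c d => loopfree c && loopfree d
  | WhilePos _ _ => false
  | _ => true
  end.

(** Loop-free commands act as total functions; the value at [WhilePos] is a dummy, excluded by
    [loopfree] in [exec_step]. *)
Fixpoint step c s : state :=
  match c with
  | Assign x e => set_var s x (eval s e)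
  | Put a e f => set_cell s a `|eval s e|%N (eval s f)
  | Seq c d => step d (step c s)
  | IfPos e c d => if 0 < eval s e then step c s else step d s
  | _ => s
  end.

(** Factor by which a command may multiply the bit bound [M]; for [IfPos] the sum stands in for the
    maximum. *)
Fixpoint growth c : nat :=
  match c with
  | Assign _ e | Put _ _ e => esize e
  | Seq c d => growth c * growth d
  | IfPos _ c d => growth c + growth d
  | _ => 1
  end.

Fixpoint units c : nat :=
  match c with
  | Assign _ e => (eunits e).+1
  | Put _ e f => (eunits e + eunits f).+1
  | Seq c d => (units c + growth c * units d).+1
  | IfPos e c d => (eunits e + units c + units d).+1
  | _ => 1
  end.

Lemma growth_gt0 c : (0 < growth c)%N.
Proof.
elim: c => //= [_ e|_ _ e|c IHc d IHd|_ c IHc d _]; rewrite ?esize_gt0 //.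
  by rewrite muln_gt0 IHc.
by rewrite addn_gt0 IHc.
Qed.

Lemma bounded_le M M' s : (M <= M')%N -> bounded M s -> bounded M' s.
Proof. by move=> MM [v a]; split=> *; apply: leq_2exp2 MM _. Qed.

Lemma bounded_set_var M s x z :
  bounded M s -> (`|z| <= 2 ^ M)%N -> bounded M (set_var s x z).
Proof. by move=> [v a] zM; split=> //= y; case: ifP. Qed.

Lemma bounded_set_cell M s a i z :
  bounded M s -> (`|z| <= 2 ^ M)%N -> bounded M (set_cell s a i z).
Proof. by move=> [v b] zM; split=> //= y j; case: ifP. Qed.

Lemma bounded_step M c s : (0 < M)%N -> bounded M s ->
  bounded (M * growth c) (step c s).
Proof.
elim: c M s => [|x e|a e f|c IHc d IHd|e c IHc d IHd|e c _] M s M0 bs /=;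
  rewrite ?muln1 //.
- apply: bounded_set_var (eval_bounded e M0 bs).
  by apply: bounded_le bs; rewrite leq_pmulr // esize_gt0.
- apply: bounded_set_cell (eval_bounded f M0 bs).
  by apply: bounded_le bs; rewrite leq_pmulr // esize_gt0.
- by rewrite mulnA; apply: IHd (IHc _ _ _ _) => //; rewrite muln_gt0 M0 growth_gt0.
- by case: ifP => _; [apply: bounded_le (IHc _ _ M0 bs) | apply: bounded_le (IHd _ _ M0 bs)];
    rewrite leq_mul2l ?leq_addr ?leq_addl orbT.
Qed.

Lemma exec_step M c s : loopfree c -> (0 < M)%N -> bounded M s ->
  exists2 T, exec c s T (step c s) & (T <= units c * M)%N.
Proof.
elim: c M s => [|x e|a e f|c IHc d IHd|e c IHc d IHd|//] M s /=.
- by move=> _ M0 _; exists 1%N; [exact: ExecSkip | rewrite mul1n].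
- move=> _ M0 bs; exists (cost s e).+1; first exact: ExecAssign.
  by have := cost_bounded e M0 bs; nia.
- move=> _ M0 bs; exists (cost s e + cost s f).+1; first exact: ExecPut.
  by have := cost_bounded e M0 bs; have := cost_bounded f M0 bs; nia.
- move=> /andP[lc ld] M0 bs; have [T Tc Tb] := IHc M s lc M0 bs.
  have M1 : (0 < M * growth c)%N by rewrite muln_gt0 M0 growth_gt0.
  have [U Ud Ub] := IHd _ _ ld M1 (bounded_step c M0 bs).
  by exists (T + U).+1; [exact: ExecSeq Tc Ud | nia].
- move=> /andP[lc ld] M0 bs; have ce := cost_bounded e M0 bs.
  case: ifPn => [e0|]; [|rewrite -leNgt => e0].
    have [T Tc Tb] := IHc M s lc M0 bs.
    by exists (cost s e + T).+1; [exact: ExecIfTrue | nia].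
  have [T Tc Tb] := IHd M s ld M0 bs.
  by exists (cost s e + T).+1; [exact: ExecIfFalse | nia].
Qed.

(** A total-correctness triple with time bound [B]. *)
Definition runs c s (B : nat) Q : Prop :=
  exists T s', [/\ exec c s T s', (T <= B)%N & Q s'].

Lemma runs_step M K c s Q : loopfree c -> (0 < M <= K)%N -> bounded M s ->
  Q (step c s) -> runs c s (units c * K) Q.
Proof.
move=> lc /andP[M0 MK] bs Qs; have [T Tc Tb] := exec_step lc M0 bs.
by exists T, (step c s); split=> //; rewrite (leq_trans Tb) // leq_mul2l MK orbT.
Qed.

Lemma runs_seq c d s B B' Q :
  runs c s B (fun s' => runs d s' B' Q) -> runs (Seq c d) s (B + B').+1 Q.
Proof.
move=> [T [s' [Tc Tb [U [s'' [Ud Ub Qs]]]]]].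
exists (T + U).+1, s''; split=> //; first exact: ExecSeq Tc Ud.
by rewrite ltnS leq_add.
Qed.

Lemma runs_weaken c s B B' Q : (B <= B')%N -> runs c s B Q -> runs c s B' Q.
Proof. by move=> BB [T [s' [? TB ?]]]; exists T, s'; split=> //; apply: leq_trans BB. Qed.

(** The invariant must restore the same bit bound [M] at every iteration; otherwise the [growth] of
    the body would compound exponentially. The guard is evaluated [n + 1] times. *)
Lemma runs_loop (Inv : nat -> state -> Prop) M K b n e c s : (0 < M <= K)%N ->
  (forall k s, (k <= n)%N -> Inv k s -> bounded M s /\ (0 < eval s e) = (k < n)%N) ->
  (forall k s, (k < n)%N -> Inv k s -> runs c s (b * K) (Inv k.+1)) ->
  Inv 0%N s -> runs (WhilePos e c) s ((eunits e + 1 + b) * (K * n.+1)) (Inv n).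
Proof.
move=> /andP[M0 MK] guard body I0.
suff H m k s' : (k + m = n)%N -> Inv k s' ->
    runs (WhilePos e c) s' ((eunits e + 1 + b) * (K * m.+1)) (Inv n) by exact: (H n 0%N).
elim: m k s' => [|m IHm] k s' km Ik.
  have [|bs ge] := guard k s' _ Ik; first by rewrite -km leq_addr.
  exists (cost s' e).+1, s'; split; last by rewrite -km addn0.
    by apply: ExecWhileFalse; rewrite leNgt ge -km addn0 ltnn.
  have := cost_bounded e M0 bs; nia.
have kn : (k < n)%N by rewrite -km -addSnnS leq_addr.
have [bs ge] := guard k s' (ltnW kn) Ik; rewrite kn in ge.
have [T [s1 [Tc Tb I1]]] := body k s' kn Ik.
have [|U [s2 [Uc Ub I2]]] := IHm k.+1 s1 _ I1; first by rewrite addSnnS.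
exists (cost s' e + T + U).+1, s2; split=> //; first exact: ExecWhileTrue Tc Uc.
have := cost_bounded e M0 bs; move: Tb Ub; rewrite (mulnS K).
by move: (cost s' e) (eunits e) => ce ee; move: (K * m.+1)%N => X; nia.
Qed.

End Timing.

(** * A list scheduling program *)

Local Notation vn := (Var 0).
Local Notation vj := (Var 1).
Local Notation vi := (Var 2).
Local Notation vrank := (Var 3).
Local Notation vnum := (Var 4).
Local Notation vden := (Var 5).
Local Notation vearly := (Var 6).
Local Notation vidle := (Var 7).
Local Notation one := (Const (Posz 1)).

(* Job [j] occupies the input cells from [6 j + 2] on, so that [cell 4] and
   [cell 5] are the numerator and denominator of its weight; those of the first
   supply follow the same pattern with [j = n], and those of the second supply
   time are [cell 6] and [cell 7] there. *)
Definition cell (k : nat) (e : expr) : expr :=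
  Get 0 (Add (Mul (Const (Posz 6)) e) (Const (Posz k))).

Definition weight_diff : expr :=
  Defs.Sub (Mul (cell 4 vi) (cell 5 vj)) (Mul (cell 4 vj) (cell 5 vi)).

(* For [i, j < n] this is positive iff job [i] comes before or is job [j]: the
   tie-break by index lies in ]-n, n], so it decides only when the weights are
   equal. *)
Definition precedes : expr :=
  Add (Mul weight_diff vn) (Add (Defs.Sub vj vi) one).

Definition inner_update : cmd :=
  Seq (Assign 3 (Add vrank one))
  (Seq (Assign 4 (Add (Mul vnum (cell 5 vi)) (Mul (cell 4 vi) vden)))
       (Assign 5 (Mul vden (cell 5 vi)))).

Definition inner_body : cmd :=
  Seq (IfPos precedes inner_update Skip)
      (Assign 2 (Add vi one)).

Definition outer_pre : cmd :=
  Seq (Assign 2 (Const 0)) (Seq (Assign 3 (Const 0))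
  (Seq (Assign 4 (Const 0)) (Assign 5 one))).

(** Array 2 stores ranks, array 3 the flags of late jobs, variable 6 counts early jobs. The test
    compares the prefix sum with the first supply by cross-multiplication. *)
Definition outer_post : cmd :=
  Seq (Put 2 vj vrank)
  (Seq (IfPos (Defs.Sub (Mul vnum (cell 5 vn)) (Mul (cell 4 vn) vden))
         (Put 3 vj one)
         (Assign 6 (Add vearly one)))
       (Assign 1 (Add vj one))).

Definition outer_body : cmd :=
  Seq outer_pre (Seq (WhilePos (Defs.Sub vn vi) inner_body) outer_post).

Definition between : cmd :=
  Seq (Assign 7 (Defs.Sub (cell 6 vn) (Mul vearly (cell 7 vn))))
  (Seq (IfPos vidle Skip (Assign 7 (Const 0)))
       (Assign 1 (Const 0))).

(* With rank [r] (counted from 1), the start time is [r - 1] plus, for late jobs,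
   the idle time; [u]'s denominator is a common denominator. *)
Definition output_body : cmd :=
  Seq (Put 1 (Add vj vj)
        (Add (Mul (Defs.Sub (Get 2 vj) one) (cell 7 vn)) (Mul (Get 3 vj) vidle)))
  (Seq (Put 1 (Add (Add vj vj) one) (cell 7 vn))
       (Assign 1 (Add vj one))).

Definition program : cmd :=
  Seq (Assign 0 (Get 0 (Const 0)))
  (Seq (WhilePos (Defs.Sub vn vj) outer_body)
  (Seq between (WhilePos (Defs.Sub vn vj) output_body))).

(** * Loop invariants, size bounds and results of the program *)

Section Program.
Variables (inp : nat -> int) (n L : nat).
Hypothesis inp0 : inp 0 = n.
Hypothesis inp_le : forall k, (`|inp k| <= 2 ^ L)%N.
Hypothesis n_le : (n <= L)%N.

Let num (i : nat) : int := inp (6 * i + 4).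
Let den (i : nat) : int := inp (6 * i + 5).
Hypothesis den_gt0 : forall i, (i <= n)%N -> 0 < den i.

Let frac (i : nat) : rat := (num i)%:Q / (den i)%:Q.

(** Reflexive, so that [rank] counts from 1 and the prefix sum in [late_job] includes job [j]
    itself. *)
Definition before (i j : nat) : bool :=
  (frac j < frac i) || ((frac i == frac j) && (i <= j)%N).

Definition rank (j : nat) : nat := \sum_(i < n) before i j.

(** By the input layout, [frac n] is the first supply. *)
Definition late_job (j : nat) : bool := frac n < \sum_(i < n | before i j) frac i.

Definition early (k : nat) : nat := \sum_(j < k) ~~ late_job j.

(** A running sum of [n] fractions fits in [n * L.+1] bits; the extra [4 * L.+1] leaves room for
    counters and for start times, of at most [2 * L + 2] bits. *)
Let M := (n.+4 * L.+1)%N.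

Lemma n_lt_exp : (n < 2 ^ L)%N.
Proof. by rewrite (leq_ltn_trans n_le) // ltn_expl. Qed.

Lemma M_gt0 : (0 < M)%N. Proof. by rewrite muln_gt0. Qed.

Lemma exp_leM k (x : nat) : (k <= n)%N -> (x <= 2 ^ (k * L.+1))%N -> (x <= 2 ^ M)%N.
Proof. by move=> kn; apply: leq_2exp2; rewrite leq_mul2r orbC (leq_trans kn) // !leqW. Qed.

Lemma n_leM (x : nat) : (x <= n)%N -> (x <= 2 ^ M)%N.
Proof.
move=> xn; apply: leq_2exp2 (leq_trans xn (ltnW n_lt_exp)).
by rewrite /M; nia.
Qed.

Lemma beforeE (i j : nat) : (i < n)%N -> (j < n)%N ->
  (0 < (num i * den j - num j * den i) * n + (j%:Z - i%:Z + 1)) = before i j.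
Proof.
move=> i_n j_n; rewrite /before /frac.
have di : 0 < (den i)%:Q by rewrite ltr0z den_gt0 // ltnW.
have dj : 0 < (den j)%:Q by rewrite ltr0z den_gt0 // ltnW.
have di0 := lt0r_neq0 di; have dj0 := lt0r_neq0 dj.
rewrite ltr_pdivrMr // mulrAC ltr_pdivlMr // eqr_div // -!intrM ltr_int eqr_int.
move: (num i * den j) (num j * den i) => x y.
by apply/idP/idP; case: (ltgtP x y) => //= xy; nia.
Qed.

(* Each step adds at most [L + 1] bits to the numerator and denominator of the
   running sum. *)
Definition inner_inv (s0 : state) (j k : nat) (s : state) : Prop :=
  [/\ bounded M s, arr s = arr s0,
      [/\ var s 0 = n, var s 1 = j, var s 2 = k & var s 6 = var s0 6],
      var s 3 = (\sum_(i < k) before i j)%N &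
      [/\ (`|var s 4| <= 2 ^ (k * L.+1))%N, (`|var s 5| <= 2 ^ (k * L.+1))%N,
         0 < var s 5 &
         (var s 4)%:Q / (var s 5)%:Q = \sum_(i < k | before i j) frac i]].

Lemma eval_cell s (k i : nat) e : (forall i, arr s 0 i = inp i) ->
  eval s e = i -> eval s (cell k e) = inp (6 * i + k).
Proof. by move=> sI /= ->; rewrite -sI. Qed.

Lemma inner_step s0 j k s : (forall i, arr s0 0 i = inp i) ->
  (j < n)%N -> (k < n)%N ->
  inner_inv s0 j k s -> inner_inv s0 j k.+1 (step inner_body s).
Proof.
move=> s0i jn kn [bs as0 [s_0 s_1 s_2 s_6] s_3 [n4 n5 p5 sum]].
have sI i : arr s 0 i = inp i by rewrite as0.
have cellE c (i : nat) e : eval s e = i -> eval s (cell c e) = inp (6 * i + c).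
  exact: eval_cell.
have cond : (0 < eval s precedes) = before k j.
  rewrite -beforeE //.
  have -> : eval s precedes = (eval s (cell 4 vi) * eval s (cell 5 vj) -
    eval s (cell 4 vj) * eval s (cell 5 vi)) * var s 0 + (var s 1 - var s 2 + 1) by [].
  by rewrite !(cellE _ k vi) // !(cellE _ j vj) // s_0 s_1 s_2.
have upd : step inner_update s = set_var (set_var (set_var s 3 (var s 3 + 1))
    4 (var s 4 * den k + num k * var s 5)) 5 (var s 5 * den k).
  by rewrite /den /num -!(cellE _ k vi).
have -> : step inner_body s = step (Assign 2 (Add vi one))
    (if before k j then step inner_update s else s) by rewrite -cond.
have n2 : (k.+1 <= 2 ^ M)%N by rewrite n_leM.
have rk : (\sum_(i < k) before i j <= k)%N.
  by rewrite -[leqRHS]card_ord -sum1_card leq_sum // => i _; case: before.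
have kL : (2 ^ (k * L.+1) * 2 ^ L + 2 ^ L * 2 ^ (k * L.+1) <= 2 ^ (k.+1 * L.+1))%N.
  by rewrite [(2 ^ L * _)%N]mulnC addnn -mul2n mulnCA -expnS -expnD mulSn addnC.
have kk : (2 ^ (k * L.+1) <= 2 ^ (k.+1 * L.+1))%N.
  by rewrite leq_exp2l // leq_mul2r leqnSn orbT.
have sk : absz (k%:Z + 1) = k.+1 by rewrite -PoszD addn1.
have dk := den_gt0 (ltnW kn).
have sumS : \sum_(i < k.+1 | before i j) frac i =
    \sum_(i < k | before i j) frac i + (if before k j then frac k else 0).
  by rewrite big_mkcond big_ord_recr -big_mkcond.
have rankS : (\sum_(i < k.+1) before i j = \sum_(i < k) before i j + before k j)%N.
  by rewrite big_ord_recr.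
rewrite /inner_inv sumS rankS {sumS rankS cond}.
case: (before k j); rewrite ?upd {upd} /= s_2.
- have b4 : (`|(var s 4 * den k + num k * var s 5)%R| <= 2 ^ (k.+1 * L.+1))%N.
    apply: leq_trans kL; apply: (@leq_trans (`|(var s 4 * den k)%R| + `|(num k * var s 5)%R|)).
      lia.
    by rewrite !abszM leq_add // leq_mul // inp_le.
  have b5 : (`|(var s 5 * den k)%R| <= 2 ^ (k.+1 * L.+1))%N.
    by rewrite abszM (leq_trans _ kL) // (leq_trans _ (leq_addr _ _)) // leq_mul // inp_le.
  split => //.
  + apply: bounded_set_var; last by rewrite sk.
    apply: bounded_set_var; last exact: exp_leM b5.
    apply: bounded_set_var; last exact: exp_leM b4.
    by apply: bounded_set_var => //; rewrite s_3 n_leM //; lia.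
  + split=> //; lia.
  + by rewrite s_3.
  + split=> //; first by rewrite mulr_gt0.
    rewrite -sum /frac !intrD !intrM.
    have := lt0r_neq0 p5; have := lt0r_neq0 dk.
    rewrite -!(intr_eq0 rat) => h1 h2; field; exact/andP.
- split=> //.
  + by apply: bounded_set_var => //; rewrite sk.
  + split=> //; lia.
  + by rewrite addn0.
  + split=> //; rewrite ?addr0 //; exact: leq_trans kk.
Qed.

(** Early jobs leave their cell of array 3 untouched, so the last clause records that the pending
    cells are still 0. *)
Definition outer_inv (k : nat) (s : state) : Prop :=
  [/\ bounded M s, forall i, arr s 0 i = inp i,
      [/\ var s 0 = n, var s 1 = k & var s 6 = early k],
      forall j, (j < k)%N -> arr s 2 j = rank j /\ arr s 3 j = late_job j &
      forall j, (k <= j)%N -> arr s 3 j = 0].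

Definition outer_units : nat :=
  units outer_pre + (eunits (Defs.Sub vn vi) + 1 + units inner_body) +
  units outer_post + 2.

Lemma early_le k : (early k <= k)%N.
Proof.
by rewrite -[leqRHS]card_ord -sum1_card leq_sum // => i _; case: late_job.
Qed.

Lemma rank_le j : (rank j <= n)%N.
Proof.
by rewrite -[leqRHS]card_ord -sum1_card leq_sum // => i _; case: before.
Qed.

Lemma inner_end s j s' : (forall i, arr s 0 i = inp i) -> inner_inv s j n s' ->
  (0 < eval s' (Defs.Sub (Mul vnum (cell 5 vn)) (Mul (cell 4 vn) vden))) = late_job j.
Proof.
move=> sI [_ arrs [s_0 _ _ _] _ [_ _ p5 sum]].
have s'I i : arr s' 0 i = inp i by rewrite arrs.
have -> : eval s' (Defs.Sub (Mul vnum (cell 5 vn)) (Mul (cell 4 vn) vden)) =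
  var s' 4 * eval s' (cell 5 vn) - eval s' (cell 4 vn) * var s' 5 by [].
rewrite !(@eval_cell s' _ n vn) // subr_gt0 /late_job -sum /frac.
have dn : 0 < (den n)%:Q by rewrite ltr0z den_gt0.
have d5 : 0 < (var s' 5)%:Q by rewrite ltr0z.
by rewrite ltr_pdivrMr // mulrAC ltr_pdivlMr // -!intrM ltr_int.
Qed.

Lemma outer_step k s : (k < n)%N -> outer_inv k s ->
  runs outer_body s (outer_units * (M * n.+1)) (outer_inv k.+1).
Proof.
move=> kn [bs sI [s_0 s_1 s_6] done todo].
have MK : (0 < M <= M * n.+1)%N by rewrite M_gt0 leq_pmulr.
(* The inner loop dominates, so all three phases are priced in the unit [M * n.+1]. *)
apply: (@runs_weaken _ _ (units outer_pre * (M * n.+1) +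
  ((eunits (Defs.Sub vn vi) + 1 + units inner_body) * (M * n.+1) +
   units outer_post * (M * n.+1)).+1).+1).
  rewrite /outer_units; move: (units _) (_ + _ + units _)%N (units outer_post) => x y z.
  by have := M_gt0; move: M => X X0; nia.
have e0 a : (0 <= 2 ^ a)%N by [].
have e1 a : (1 <= 2 ^ a)%N by rewrite expn_gt0.
apply: runs_seq; apply: (runs_step _ MK bs) => //.
apply: runs_seq.
have MM : (0 < M <= M)%N by rewrite M_gt0 leqnn.
have := @runs_loop (inner_inv s k) M M (units inner_body) n (Defs.Sub vn vi)
  inner_body (step outer_pre s) MM.
case=> [i s1 i_n [b1 _ [s1_0 _ s1_2 _] _ _]|i s1 i_n inv1||T [s' [ex Tb inv]]].
- by split=> //; rewrite /= s1_0 s1_2; lia.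
- apply: (runs_step _ MM) => //; first by case: inv1.
  exact: inner_step.
- split=> //=.
  + by do 4!apply: bounded_set_var => //.
  + by rewrite big_ord0.
  + by rewrite big_ord0 mul0n !expn0; split.
exists T, s'; split=> //.
have lateE := inner_end sI inv.
have [b' arr' [s'_0 s'_1 s'_2 s'_6] s'_3 _] := inv.
apply: (runs_step _ MK b') => //.
pose s2 := set_cell s' 2 k (rank k).
pose s3 := if late_job k then set_cell s2 3 k 1 else set_var s2 6 (var s 6 + 1).
have -> : step outer_post s' = set_var s3 1 (k%:Z + 1).
  rewrite /s3 -lateE /s2 /rank -s'_3 -s'_6.
  by rewrite /= s'_1; case: ifP => _; rewrite /= s'_1.
have b2 : bounded M s2 by apply: bounded_set_cell; rewrite // n_leM // rank_le.
have eS : early k.+1 = (early k + ~~ late_job k)%N by rewrite /early big_ord_recr.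
have b3 : bounded M s3.
  rewrite /s3; case: ifP => _; first by apply: bounded_set_cell.
  apply: bounded_set_var => //; rewrite s_6 n_leM //.
  by rewrite -PoszD addn1 /= (leq_ltn_trans (early_le k)).
split.
- by apply: bounded_set_var => //; rewrite -PoszD addn1 n_leM.
- by move=> i; rewrite -sI /s3; case: ifP => _; rewrite /= arr'.
- split.
  + by rewrite /s3; case: (late_job k); rewrite /= s'_0.
  + by rewrite /= -PoszD addn1.
  + rewrite eS /s3; case: (late_job k); first by rewrite /= s'_6 s_6 addn0.
    by rewrite /= s_6 -PoszD.
- move=> j; rewrite ltnS leq_eqVlt => /orP[/eqP ->|jk].
    rewrite /s3; case E: (late_job k); rewrite /= !eqxx //=; split=> //.
    by rewrite arr' todo.
  have [d1 d2] := done j jk; rewrite -d1 -d2 /s3.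
  by case: (late_job k); rewrite /= (ltn_eqF jk) /= arr'.
- move=> j kj; rewrite -(todo j (ltnW kj)) /s3.
  by case: (late_job k); rewrite /= ?(gtn_eqF kj) /= arr'.
Qed.

Let u_num : int := inp (6 * n + 6).
Let u_den : int := inp (6 * n + 7).

Definition idle_num : int := Num.max 0 (u_num - (early n)%:Z * u_den).

Definition start_num (j : nat) : int :=
  ((rank j)%:Z - 1) * u_den + (late_job j : nat)%:Z * idle_num.

Lemma mul_n_le (x : nat) z : (x <= n)%N -> (`|z| <= 2 ^ L)%N ->
  (x * `|z| <= 2 ^ (2 * L))%N.
Proof.
by move=> xn zL; rewrite mul2n -addnn expnD leq_mul // (leq_trans xn) // ltnW ?n_lt_exp.
Qed.

Lemma idle_num_le : (`|idle_num| <= 2 ^ (2 * L).+1)%N.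
Proof.
have h1 : (`|u_num| <= 2 ^ L)%N by exact: inp_le.
have := mul_n_le (early_le n) (inp_le (6 * n + 7)); rewrite -/u_den => h2.
have h3 : (2 ^ L <= 2 ^ (2 * L))%N by rewrite leq_exp2l // leq_pmull.
have : (`|(u_num - (early n)%:Z * u_den)%R| <= `|u_num| + early n * `|u_den|)%N.
  by rewrite -{2}(absz_nat (early n)) -abszM; lia.
by rewrite /idle_num expnS; case: leP => _ //; lia.
Qed.

Lemma start_num_le j : (j < n)%N -> (`|start_num j| <= 2 ^ M)%N.
Proof.
move=> jn; apply: (@leq_2exp2 (2 * L).+2); first by rewrite /M; nia.
have r1 : (`|((rank j)%:Z - 1)%R| <= n)%N by have := rank_le j; lia.
have h1 := mul_n_le r1 (inp_le (6 * n + 7)); have h2 := idle_num_le.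
rewrite /start_num -/u_den -abszM in h1 *; move: h1 h2; rewrite !expnS.
by case: (late_job j); lia.
Qed.

Definition output_inv (k : nat) (s : state) : Prop :=
  [/\ bounded M s, forall i, arr s 0 i = inp i,
      [/\ var s 0 = n, var s 1 = k & var s 7 = idle_num],
      forall j, (j < n)%N -> arr s 2 j = rank j /\ arr s 3 j = late_job j &
      forall j, (j < k)%N -> arr s 1 j.*2 = start_num j /\ arr s 1 j.*2.+1 = u_den].

Lemma output_step k s : (k < n)%N ->
  output_inv k s -> output_inv k.+1 (step output_body s).
Proof.
move=> kn [bs sI [s_0 s_1 s_7] rl done].
pose s1 := set_cell (set_cell s 1 k.*2 (start_num k)) 1 k.*2.+1 u_den.
have -> : step output_body s = set_var s1 1 (k%:Z + 1).
  have [rk lk] := rl k kn.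
  rewrite /s1 /start_num -rk -lk -s_7 /u_den -(@eval_cell s 7 n vn sI s_0).
  by rewrite /= s_1 s_0 /= addnn addn1.
have dM : (`|u_den| <= 2 ^ M)%N.
  by apply: leq_2exp2 (inp_le _); rewrite /M; nia.
split=> //.
- apply: bounded_set_var; last by rewrite -PoszD addn1 n_leM.
  apply: bounded_set_cell => //; apply: bounded_set_cell => //.
  exact: start_num_le.
- by rewrite /= -PoszD addn1.
- move=> j; rewrite ltnS leq_eqVlt => /orP[/eqP ->|jk]; rewrite /=.
    by rewrite !eqxx /= ifN // ltn_eqF.
  have [d1 d2] := done j jk.
  rewrite !ifN //; [lia|lia|lia|lia].
Qed.

Lemma output_start s : outer_inv n s -> output_inv 0 (step between s).
Proof.
move=> [bs sI [s_0 s_1 s_6] rl _].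
pose x := u_num - (early n)%:Z * u_den.
have -> : step between s = set_var (if 0 < x then set_var s 7 x
    else set_var (set_var s 7 x) 7 0) 1 0.
  rewrite /x /u_num /u_den -(@eval_cell s 6 n vn sI s_0).
  by rewrite -(@eval_cell s 7 n vn sI s_0) -s_6.
have [x0|x0] := ltP 0 x.
  have xE : x = idle_num by rewrite /idle_num -/x max_r // ltW.
  split=> //.
  do 2!apply: bounded_set_var => //.
  by rewrite xE; apply: leq_2exp2 idle_num_le; rewrite /M; nia.
have idle0 : idle_num = 0 by rewrite /idle_num -/x max_l.
split=> //.
(* Variable 7 ends as 0, so the bound is checked on the final state, where the intermediate [x] has
   been overwritten. *)
by have [v a] := bs; split=> //= y; do 3?case: ifP.
Qed.

Definition program_units : nat :=
  units (Assign 0 (Get 0 (Const 0))) +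
  (eunits (Defs.Sub vn vj) + 1 + outer_units) + units between +
  (eunits (Defs.Sub vn vj) + 1 + units output_body) + 3.

Lemma program_runs :
  runs program (State (fun _ => 0) (fun a i => if a == 0%N then inp i else 0))
    (program_units * (M * n.+1 * n.+1))
    (fun s => forall j, (j < n)%N -> arr s 1 j.*2 = start_num j /\ arr s 1 j.*2.+1 = u_den).
Proof.
set s0 := State _ _.
have MM : (0 < M <= M)%N by rewrite M_gt0 leqnn.
have MK : (0 < M <= M * n.+1)%N by rewrite M_gt0 leq_pmulr.
have b0 : bounded M s0.
  split=> // a i /=; case: ifP => // _.
  by apply: leq_2exp2 (inp_le _); rewrite /M; nia.
apply: (@runs_weaken _ _ (units (Assign 0 (Get 0 (Const 0))) * M +
  ((eunits (Defs.Sub vn vj) + 1 + outer_units) * (M * n.+1 * n.+1) +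
   (units between * M +
    (eunits (Defs.Sub vn vj) + 1 + units output_body) * (M * n.+1)).+1).+1).+1).
  rewrite /program_units.
  move: (units (Assign _ _)) (_ + outer_units)%N (units between) (_ + units output_body)%N.
  move=> x y z t; have := M_gt0; move: M => X X0.
  have h1 : (X <= X * n.+1 * n.+1)%N by rewrite -mulnA leq_pmulr.
  have h2 : (X * n.+1 <= X * n.+1 * n.+1)%N by rewrite leq_pmulr.
  move: (X * n.+1 * n.+1)%N (X * n.+1)%N h1 h2 => Y Z; nia.
apply: runs_seq; apply: (runs_step _ MM b0) => //.
apply: runs_seq.
have := @runs_loop outer_inv M (M * n.+1) outer_units n (Defs.Sub vn vj)
  outer_body (step (Assign 0 (Get 0 (Const 0))) s0) MK.
case=> [k s k_n [bs _ [s_0 s_1 _] _ _]|k s k_n|| T [s [ex Tb inv]]].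
- by split=> //; rewrite /= s_0 s_1; lia.
- exact: outer_step.
- split=> //=.
  + by apply: bounded_set_var => //=; rewrite inp0 n_leM.
  + by rewrite inp0 /early big_ord0.
exists T, s; split=> //; apply: runs_seq.
have bs : bounded M s by case: inv.
apply: (runs_step _ MM bs) => //.
have := @runs_loop output_inv M M (units output_body) n (Defs.Sub vn vj)
  output_body (step between s) MM.
case=> [k s' k_n [bs' _ [s_0 s_1 _] _ _]|k s' k_n inv'||U [s' [ex' Ub [_ _ _ _ out]]]].
- by split=> //; rewrite /= s_0 s_1; lia.
- apply: (runs_step _ MM) => //; first by case: inv'.
  exact: output_step.
- exact: output_start.
by exists U, s'; split.
Qed.

End Program.

(** * Layout and size of the encoded input *)

Section Encoding.

(** Random access into blocks of equal size [m]. The index [i = size s] is allowed and reads the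
    tail at any offset, as the program does for the supplies. *)
Lemma nth_flatten_map (T : Type) (T' : Type) (x0 : T) (y0 : T') m (f : T' -> seq T) s t i r :
  (forall x, size (f x) = m) -> (i <= size s)%N -> (i < size s -> r < m)%N ->
  nth x0 (flatten [seq f x | x <- s] ++ t) (m * i + r) =
  if (i < size s)%N then nth x0 (f (nth y0 s i)) r else nth x0 t r.
Proof.
move=> sf; elim: s i => [|x s IHs] [|i] //= i_s rm; rewrite ?muln0 ?add0n //.
  by rewrite -catA nth_cat sf rm.
rewrite -catA nth_cat sf ltnNge mulnS -addnA leq_addr /= addKn.
by rewrite IHs.
Qed.

Lemma nth_le_bits (s : seq int) k : (`|nth 0%R s k| <= 2 ^ sumn [seq bits z | z <- s])%N.
Proof.
elim: s k => [|z s IHs] [|k] //=.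
  by apply: leq_2exp2 (ltnW (absz_lt_bits z)); rewrite (leq_trans (leq_pred _)) ?leq_addr.
by apply: leq_2exp2 (IHs k); rewrite leq_addl.
Qed.

Lemma size_le_bits (s : seq int) : (size s <= sumn [seq bits z | z <- s])%N.
Proof. by elim: s => //= z s IHs; rewrite -add1n leq_add. Qed.

Lemma two_supplies (I : instance) : unit_equal_two_supplies I ->
  exists u b1 b2 : rat,
    [/\ [/\ 0 < u, 0 < b1 & 0 < b2],
        \sum_j req (i := I) j = b1 + b2,
        (forall (R : realType) (t : R), 0 <= t ->
           supplied I t = ratr b1 + (if ratr u <= t then ratr b2 else 0)) &
        flatten [seq encode_rat (supp_time l) ++ encode_rat (supp_qty l)
          | l <- enum 'I_(nsupp I)] =
        [:: 0; 1; numq b1; denq b1; numq u; denq u; numq b2; denq b2]].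
Proof.
(* Destructuring turns the number of supplies into a variable, which can then be replaced by 2
   inside the dependent types. *)
case: I => n q p w a ut uq [[/= _ _ _ _ u0 ult uq0 tot] _ _ /= q2].
move: ut uq u0 ult uq0 tot; rewrite q2 => ut uq u0 ult uq0 tot.
have ut0 : ut ord0 = 0 by exact: u0.
exists (ut (lift ord0 ord0)), (uq ord0), (uq (lift ord0 ord0)); split.
- by rewrite !uq0 -ut0 ult.
- by rewrite tot !big_ord_recl big_ord0 addr0.
- move=> R t t0; rewrite /supplied big_mkcond !big_ord_recl big_ord0 /= addr0 /=.
  by rewrite ut0 rmorph0 t0.
- by rewrite !enum_ordSl enum_ord0 /= ut0.
Qed.

(** Two header cells precede the job blocks, so cell [6 * j + 4] is entry 2 of block [j], and the
    supplies start at cell [6 * njobs I + 2]. *)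
Lemma encode_nth (I : instance) (t : seq int) :
  flatten [seq encode_rat (supp_time l) ++ encode_rat (supp_qty l)
          | l <- enum 'I_(nsupp I)] = t ->
  [/\ nth 0 (encode I) 0 = njobs I,
      forall (j : 'I_(njobs I)), nth 0 (encode I) (6 * j + 4) = numq (weight j),
      forall (j : 'I_(njobs I)), nth 0 (encode I) (6 * j + 5) = denq (weight j) &
      forall r, nth 0 (encode I) (6 * njobs I + r.+2) = nth 0 t r].
Proof.
rewrite /encode => ->; pose f (j : 'I_(njobs I)) := encode_rat (proc j) ++
  encode_rat (weight j) ++ encode_rat (req j).
have sf j : size (f j) = 6 by [].
split=> // [j|j|r]; rewrite !addnS /= -?addnS -/f.
- rewrite (nth_flatten_map 0 j _ _ _) ?size_enum_ord //.
    by rewrite ltn_ord nth_ord_enum.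
  exact: ltnW.
- rewrite (nth_flatten_map 0 j _ _ _) ?size_enum_ord //.
    by rewrite ltn_ord nth_ord_enum.
  exact: ltnW.
(* Without jobs there is no default element for [nth_flatten_map], hence the separate case. *)
- case: (njobs I) f sf => [|n] f sf; first by rewrite enum_ord0.
  by rewrite (nth_flatten_map 0 ord0 _ sf) ?size_enum_ord ?ltnn.
Qed.

End Encoding.

(** * Ranks in a finite total order *)

Section RankPerm.
Variables (n : nat) (r : rel 'I_n).
Hypotheses (r_total : total r) (r_trans : transitive r) (r_anti : antisymmetric r).

Let downset_card (j : 'I_n) : nat := \sum_i r i j.

(** If [r i j] fails, the downset of [j] is contained in that of [i] and misses [i] itself, so it is
    strictly smaller. *)
Lemma downset_card_le i j : (downset_card i <= downset_card j)%N = r i j.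
Proof.
have rr k : r k k by have := r_total k k; rewrite orbb.
apply/idP/idP => [|rij]; last first.
  apply: leq_sum => k _; case rki: (r k i) => //.
  by rewrite (r_trans rki rij).
apply: contraTT => nij; have rji : r j i by have := r_total i j; rewrite (negbTE nij).
rewrite -ltnNge /downset_card (bigD1 i) //= [ltnRHS](bigD1 i) //= rr (negbTE nij).
rewrite add0n add1n ltnS; apply: leq_sum => k _; case rkj: (r k j) => //.
by rewrite (r_trans rkj rji).
Qed.

Lemma downset_card_gt0 j : (0 < downset_card j)%N.
Proof.
have rr : r j j by have := r_total j j; rewrite orbb.
by rewrite /downset_card (bigD1 j) //= rr.
Qed.

Lemma downset_card_bound j : ((downset_card j).-1 < n)%N.
Proof.
rewrite prednK ?downset_card_gt0 // -[leqRHS]card_ord -sum1_card.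
by apply: leq_sum => i _; case: r.
Qed.

(** This permutation sends an element to its position; the job order used for scheduling is its
    inverse. *)
Lemma rank_perm : exists s : {perm 'I_n},
  (forall j, (s j : nat).+1 = downset_card j) /\
  (forall i j, (s i <= s j)%N = r i j).
Proof.
pose pos j := Ordinal (downset_card_bound j).
have posE j : (pos j).+1 = downset_card j by rewrite /= prednK ?downset_card_gt0.
have pos_le i j : (pos i <= pos j)%N = r i j.
  by rewrite -ltnS -[(_ < _.+1)%N]/(_ <= _)%N !posE downset_card_le.
have pos_inj : injective pos.
  by move=> i j ij; apply: r_anti; rewrite -!pos_le ij leqnn.
by exists (perm pos_inj); split=> [j|i j]; rewrite !permE.
Qed.
End RankPerm.

(** * Correctness and polynomial running time of the program, and the conclusion *)

(** On the jobs [before] is a total order, by non-increasing weight and then index. Along it, the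
    ranks, late flags and early count of the program are those of [list_start], so the output is
    that schedule. *)
Lemma program_list_schedule (R : realType) (I : instance) (s : state) :
  unit_equal_two_supplies I ->
  let inp := nth 0 (encode I) in
  (forall j, (j < njobs I)%N -> arr s 1 j.*2 = start_num inp (njobs I) j /\
     arr s 1 j.*2.+1 = inp (6 * njobs I + 7)) ->
  exists S : 'I_(njobs I) -> R, outputs s S /\
    exists2 sigma, nonincreasing_weight sigma & list_schedule sigma S.
Proof.
move=> ueI inp out; set n := njobs I in inp out *.
have [u [b1 [b2 [[u0 b10 b20] req_sum supE encE]]]] := two_supplies ueI.
have [inp0 inp4 inp5 inpt] := encode_nth encE.
have [vI p1 wr _] := ueI.
have req0 (j : 'I_(njobs I)) : 0 < req j by rewrite -wr; exact: weight_gt0.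
pose w (j : 'I_n) : rat := weight j.
have fracE (j : 'I_n) : (inp (6 * j + 4)%N)%:Q / (inp (6 * j + 5)%N)%:Q = w j.
  by rewrite /inp inp4 inp5 divq_num_den.
have b1E : (inp (6 * n + 4)%N)%:Q / (inp (6 * n + 5)%N)%:Q = b1.
  by rewrite /inp (inpt 2) (inpt 3) divq_num_den.
pose r (i j : 'I_n) := before inp i j.
have rE i j : r i j = (w j < w i) || ((w i == w j) && (i <= j)%N).
  by rewrite /r /before !fracE.
have r_total : total r.
  by move=> i j; rewrite !rE; case: (ltgtP (w i) (w j)) => //= _; exact: leq_total.
have r_trans : transitive r.
  move=> j i k; rewrite !rE.
  case: (ltgtP (w i) (w j)) => //= [ji _|ij h1].
    case: (ltgtP (w j) (w k)) => //= [kj _|<- _]; last by rewrite ji.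
    by rewrite (lt_trans kj ji).
  rewrite ij; case: (ltgtP (w j) (w k)) => //= _; exact: leq_trans.
have r_anti : antisymmetric r.
  move=> i j; rewrite !rE; case: (ltgtP (w i) (w j)) => //= _ /anti_leq.
  exact: val_inj.
have [pos [posE pos_le]] := rank_perm r_total r_trans r_anti.
pose sigma := (pos^-1)%g.
have prefE j : prefix_req sigma (pos j) = \sum_(i < n | r i j) w i.
  rewrite /prefix_req (reindex_inj (@perm_inj _ pos)) /=.
  by apply: eq_big => [i|i _]; rewrite ?pos_le // /sigma permK /w wr.
have lateE j : late b1 sigma (pos j) = late_job inp n j.
  rewrite /late /late_job prefE b1E; congr (_ < _).
  by apply: eq_bigr => i _; rewrite fracE.
have earlyE : #|[pred k | ~~ late b1 sigma k]| = early inp n n.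
  rewrite -sum1_card (reindex_inj (@perm_inj _ pos)) big_mkcond /=.
  by apply: eq_bigr => j _; rewrite inE lateE; case: late_job.
have S1 : list_schedule sigma (list_start (R := R) u b1 sigma).
  exact: (list_startP p1 req0 b20 req_sum (supE R)).
exists (list_start u b1 sigma); split; last first.
  exists sigma => // i k ik; have := rE (sigma i) (sigma k).
  rewrite -pos_le /sigma !permKV ik => /esym /orP[/ltW //|/andP[/eqP]].
  by rewrite /w => ->.
move=> j; have [-> ->] := out j (ltn_ord j).
have udE : inp (6 * n + 7)%N = denq u by rewrite /inp (inpt 5).
have unE : inp (6 * n + 6)%N = numq u by rewrite /inp (inpt 4).
have du : 0 < (denq u)%:~R :> R by rewrite ltr0z denq_gt0.
split; first by rewrite udE; exact: denq_neq0.
rewrite /list_start /sigma invgK lateE /start_num udE /idle earlyE /idle_num unE udE.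
have -> : rank inp n j = (pos j).+1 by rewrite posE.
have uE : ratr u = (numq u)%:~R / (denq u)%:~R :> R by [].
rewrite -addn1 PoszD addrK intrD !intrM mulrDl mulfK ?gt_eqF //.
congr (_ + _); case: late_job; last by rewrite !mul0r.
rewrite mul1r; set e := early _ _ _.
have -> : ratr u - e%:R = (numq u - e%:Z * denq u)%:~R / (denq u)%:~R :> R.
  by rewrite uE intrB intrM mulrBl mulfK ?gt_eqF.
case: (leP 0 (numq u - e%:Z * denq u)) => h.
  (* The program truncates the numerator at 0 and [idle] the quotient; they agree because [denq u]
     is positive. *)
  by rewrite max_r // mulr_ge0 ?invr_ge0 ?ler0z // ltW.
by rewrite max_l ?mul0r // ltW // pmulr_llt0 ?invr_gt0 // ltrz0.
Qed.

Lemma program_polynomial (I : instance) : unit_equal_two_supplies I ->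
  runs program (init I) (program_units * 24 * input_size I ^ 4)
    (fun s => forall j, (j < njobs I)%N ->
      arr s 1 j.*2 = start_num (nth 0 (encode I)) (njobs I) j /\
      arr s 1 j.*2.+1 = nth 0 (encode I) (6 * njobs I + 7)).
Proof.
move=> ueI; set L := input_size I.
have [u [b1 [b2 [_ _ _ encE]]]] := two_supplies ueI.
have [inp0 _ inp5 inpt] := encode_nth encE.
have sL : (size (encode I) <= L)%N by exact: size_le_bits.
have nL : (njobs I <= L)%N.
  apply: leq_trans sL; rewrite /encode !size_cat.
  apply: leq_trans (leq_addl _ _); apply: leq_trans (leq_addr _ _).
  rewrite size_flatten /shape -map_comp (@eq_map _ _ _ (fun=> 6%N)) //.
  by rewrite sumnE big_map big_enum sum_nat_const card_ord leq_pmulr.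
have L2 : (2 <= L)%N by apply: leq_trans sL; rewrite /encode size_cat leq_addr.
have den0 i : (i <= njobs I)%N -> 0 < nth 0 (encode I) (6 * i + 5).
  rewrite leq_eqVlt => /orP[/eqP ->|i_n]; first by rewrite (inpt 3) denq_gt0.
  by rewrite (inp5 (Ordinal i_n)) denq_gt0.
have := program_runs inp0 (@nth_le_bits (encode I)) nL den0.
move: program_units => C; apply: runs_weaken.
rewrite -(mulnA C) leq_mul2l; apply/orP; right.
(* With [njobs I <= L] and [2 <= L], the factors are at most [3 * L], [2 * L], [2 * L] and [2 * L],
   whence the constant 24 and the exponent 4. *)
have h1 : ((njobs I).+4 * L.+1 <= 3 * L * (2 * L))%N by rewrite leq_mul //; lia.
have h2 : ((njobs I).+1 <= 2 * L)%N by lia.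
apply: leq_trans (leq_mul (leq_mul h1 h2) h2) _.
by rewrite !expnS expn0 muln1; nia.
Qed.

(** The program realises one way of breaking ties, by index; the factor 2 is shown for every order
    compatible with the weights. *)
Theorem theorem6 (R : realType) :
  polynomial_time unit_equal_two_supplies
    (fun (I : instance) (S : 'I_(njobs I) -> R) =>
       exists2 sigma : {perm 'I_(njobs I)},
         nonincreasing_weight sigma & list_schedule sigma S) /\
  (forall I : instance, unit_equal_two_supplies I ->
     exists2 OPT : R, is_optimum I OPT &
       forall sigma : {perm 'I_(njobs I)}, nonincreasing_weight sigma ->
         (exists S : 'I_(njobs I) -> R, list_schedule sigma S) /\
         (forall S : 'I_(njobs I) -> R, list_schedule sigma S ->
            feasible S /\ total_weighted_completion S <= 2 * OPT)).
Proof.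
split.
  exists program, (program_units * 24)%N, 4%N => I ueI.
  have [T [s [ex Tb out]]] := program_polynomial ueI.
  have [S [outS algS]] := program_list_schedule R ueI out.
  by exists T, s, S.
move=> I ueI.
have [u [b1 [b2 [[u0 b10 b20] req_sum supE _]]]] := two_supplies ueI.
have [vI p1 wr _] := ueI.
have req0 (j : 'I_(njobs I)) : 0 < req j by rewrite -wr; exact: weight_gt0.
have [opt optI] := optimum_exists p1 req0 wr b10 b20 req_sum (supE R).
exists opt => // sigma wd; split.
  by exists (list_start u b1 sigma); exact: (list_startP p1 req0 b20 req_sum (supE R)).
move=> S LS; split.
  exact: (list_schedule_feasible p1 b10 b20 (supE R) LS).
have [[S' fS' <-] _] := optI.
exact: (list_schedule_approx p1 req0 wr u0 b10 b20 req_sum (supE R) fS' wd LS).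
Qed.
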